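(* Let $0<\varepsilon\le\delta$, let $K\in(0,1]$, $\rho\ge4$, and $\alpha(s)=Ks^\rho$. Put $C=2^{1000\rho}$, $c_1=100\rho$, $c_2=2^{-128}$ and $\alpha=\alpha(\varepsilon)$. Let $W\subseteq\{1,\dots,N\}^2$ with $|W|=\delta N^2$, and suppose $N\ge(C\alpha^{c_1})^{-(1/c_2)^{1/\alpha}}$. Then there exist right squares $P_1,\dots,P_M\subseteq\{1,\dots,N\}^2$ and a set $B$ such that $W$ is the disjoint union of $W\cap P_1,\dots,W\cap P_M$ and $B$, and 1) for every $i$, $W$ is $\alpha(\delta_{P_i}(W))$-uniform in $P_i$; 2) for every $i$, $|W\cap P_i|\ge\varepsilon|P_i|$ and $|P_i|\ge N^{c_2^{1/\alpha}}$; 3) $|B|<4\varepsilon N^2$.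
   Context: A right square is a set $P=\{a,a+d,\dots,a+(t-1)d\}\times\{b,b+d,\dots,b+(t-1)d\}$ (two arithmetic progressions with the same difference $d\ge1$ and the same length $t$). For a set $E$, $\delta_P(E)=|E\cap P|/|P|$. Let $\varphi:P\to\mathbb{Z}_t^2$, $\varphi(a+kd,b+ld)=(k,l)$. $E$ is $\gamma$-uniform in $P$ if the set $S=\varphi(E\cap P)\subseteq\mathbb{Z}_t^2$, with $|S|=\eta t^2$, is $\gamma$-uniform in $\mathbb{Z}_t^2$, meaning its balanced function $g=\chi_S-\eta$ satisfies $\sum_{\vec v\in\mathbb{Z}_t^2}\big|\sum_{\vec s\in\mathbb{Z}_t^2}g(\vec s)\overline{g(\vec s-\vec v)}\big|^2\le\gamma t^6$. *)

(* Defs.v *)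
From HB Require Import structures.
From mathcomp Require Import all_boot all_order all_algebra finmap.
From mathcomp Require Import all_classical all_reals all_analysis.

Set Implicit Arguments.
Unset Strict Implicit.
Unset Printing Implicit Defensive.

Import Order.TTheory GRing.Theory Num.Theory.

Local Open Scope ring_scope.
Local Open Scope fset_scope.

Definition grid (N : nat) : {fset nat * nat} :=
  [fset i | i in iota 1 N] `*` [fset i | i in iota 1 N].

(* The length t is stored as rs_len1 = t - 1, so that t >= 1 and 'I_t carries
   its additive group structure Z_t; unlike 'Z_t, this is correct for t = 1. *)
Record right_square := RightSquare {
  rs_a : nat;
  rs_b : nat;
  rs_d : nat;
  rs_len1 : nat;
  rs_d_gt0 : (0 < rs_d)%N
}.

Definition rs_len (P : right_square) : nat := (rs_len1 P).+1.

Definition arith_prog (a d t : nat) : {fset nat} :=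
  [fset (a + k * d)%N | k in iota 0 t].

Definition rs_set (P : right_square) : {fset nat * nat} :=
  arith_prog (rs_a P) (rs_d P) (rs_len P)
    `*` arith_prog (rs_b P) (rs_d P) (rs_len P).

(* Only meaningful on rs_set P, where it sends (a + k d, b + l d) to (k, l):
   see rs_phiE. *)
Definition rs_phi (P : right_square) (x : nat * nat) :
    'I_(rs_len1 P).+1 * 'I_(rs_len1 P).+1 :=
  (inord ((x.1 - rs_a P) %/ rs_d P), inord ((x.2 - rs_b P) %/ rs_d P)).

Lemma rs_phiE (P : right_square) (k l : 'I_(rs_len1 P).+1) :
  rs_phi P (rs_a P + k * rs_d P, rs_b P + l * rs_d P)%N = (k, l).
Proof.
by rewrite /rs_phi /= !addKn !mulnK ?rs_d_gt0 // !inord_val.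
Qed.

Definition rs_image (P : right_square) (E : {fset nat * nat}) :
    {set 'I_(rs_len1 P).+1 * 'I_(rs_len1 P).+1} :=
  [set v in [seq rs_phi P x | x <- E `&` rs_set P]].

Section Uniformity.
Variable R : realType.

Definition density (E P : {fset nat * nat}) : R :=
  #|` E `&` P|%:R / #|` P|%:R.

Definition balanced (n : nat) (S : {set 'I_n.+1 * 'I_n.+1})
    (s : 'I_n.+1 * 'I_n.+1) : R :=
  (s \in S)%:R - #|S|%:R / n.+1%:R ^+ 2.

(* The balanced function is real-valued, so it is its own conjugate. *)
Definition uniform (gamma : R) (n : nat) (S : {set 'I_n.+1 * 'I_n.+1}) : Prop :=
  \sum_(v : 'I_n.+1 * 'I_n.+1)
     `| \sum_(s : 'I_n.+1 * 'I_n.+1) balanced S s * balanced S (s - v) | ^+ 2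
  <= gamma * n.+1%:R ^+ 6.

Definition uniform_in (gamma : R) (E : {fset nat * nat}) (P : right_square) :
    Prop :=
  uniform gamma (rs_image P E).

End Uniformity.

(* Main.v *)
(* The proof is an energy increment.  The energy of a family of disjoint squares
   is the sum of |W cap P|^2 / |P|, hence at most N^2.

   If W is not gamma-uniform in a square P of side t, the Fourier coefficients of
   the balanced function g satisfy sum |g^|^4 > gamma t^8, so by Parseval some
   character correlates with g.  By Dirichlet's theorem this character is nearly
   constant on squares of side about t^(1/8) with a suitable common difference
   d <= t^(1/2); cutting P into such squares raises its energy by about
   gamma |P|, at the cost of a negligible uncovered part.

   Starting from the grid, cut every square that is dense and not uniform.  Since
   eta^rho >= eta epsilon^(rho - 1) for eta >= epsilon, the energy grows by
   2 alpha N^2 per round as long as those squares carry 2 epsilon N^2 points of W,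
   so fewer than 1 / alpha + 1 rounds are performed, each replacing t by at least
   t^(1/16).  For alpha > 2^-12 the lower bound on N may be void, but then the
   grid itself is uniform, or W has fewer than 4 epsilon N^2 points. *)

Require Import Defs.
From HB Require Import structures.
From mathcomp Require Import all_boot all_order all_algebra finmap.
From mathcomp Require Import all_classical all_reals all_analysis.
From mathcomp Require Import ring lra zify.

Set Implicit Arguments.
Unset Strict Implicit.
Unset Printing Implicit Defensive.

Import Order.TTheory GRing.Theory Num.Theory.
Import numFieldNormedType.Exports.

Local Open Scope ring_scope.
Local Open Scope fset_scope.

(** * Real trigonometry: Lipschitz bound, periodicity and vanishing sums of cosines *)

Section Trigonometry.
Local Open Scope ring_scope.
Variable R : realType.

Lemma cos_lipschitz (x y : R) : `|cos x - cos y| <= `|x - y|.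
Proof.
wlog lt_yx : x y / y < x => [hw|].
  have [|lt_xy|->] := ltgtP y x; first exact: hw.
    by rewrite distrC [leRHS]distrC; exact: hw.
  by rewrite !subrr.
have drv z : z \in `]y, x[%R -> is_derive z 1 (@cos R) (- sin z).
  by move=> _; exact: is_derive_cos.
have cnt : {within `[y, x], continuous (@cos R)}%classic.
  by apply: continuous_subspaceT; exact: continuous_cos.
have [c _ ->] := MVT lt_yx drv cnt.
by rewrite normrM normrN ler_piMl // sin_max.
Qed.

Lemma cosD2pin (x : R) (k : nat) : cos (x + 2 * pi * k%:R) = cos x.
Proof.
rewrite -[RHS](periodicn (@cosD2pi R) k) /=.
by congr (cos (x + _)); rewrite -[in RHS]mulr_natr -[pi *+ 2]mulr_natl.
Qed.

Lemma cos_mod (x : R) (t a b q : nat) : (0 < t)%N -> a = (b + t * q)%N ->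
  cos (x + 2 * pi * a%:R / t%:R) = cos (x + 2 * pi * b%:R / t%:R).
Proof.
move=> t_gt0 ->; rewrite -(cosD2pin (x + 2 * pi * b%:R / t%:R) q); congr cos.
rewrite natrD natrM.
have t0 : t%:R != 0 :> R by rewrite pnatr_eq0; lia.
by field.
Qed.

(** With [be = pi j / t], each term times [2 sin be] is a difference of sines, so the sum
    telescopes, and its two ends differ by [j] full periods. Cancelling [sin be] is allowed because
    [0 < be < pi]. *)
Lemma sum_cos_eq0 (x : R) (t j : nat) : (0 < j < t)%N ->
  \sum_(k < t) cos (x + 2 * pi * (k * j)%:R / t%:R) = 0.
Proof.
move=> /andP[j_gt0 lt_jt].
have t0 : t%:R != 0 :> R by rewrite pnatr_eq0; lia.
have tp : 0 < t%:R :> R by rewrite ltr0n; lia.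
have jp : 0 < j%:R :> R by rewrite ltr0n.
have jt : j%:R < t%:R :> R by rewrite ltr_nat.
pose be : R := pi * j%:R / t%:R.
have pip := @pi_gt0 R.
have sb : 0 < sin be.
  apply: sin_gt0_pi; rewrite /be divr_gt0 ?mulr_gt0 //=.
  by rewrite ltr_pdivrMr // ltr_pM2l.
pose f (k : nat) := sin (x + (2 * k%:R - 1) * be).
have step k : 2 * sin be * cos (x + 2 * pi * (k * j)%:R / t%:R) = f k.+1 - f k.
  have -> : x + 2 * pi * (k * j)%:R / t%:R = x + 2 * k%:R * be.
    by rewrite /be natrM; field.
  rewrite /f.
  have -> : x + (2 * k.+1%:R - 1) * be = (x + 2 * k%:R * be) + be.
    by rewrite -natr1; ring.
  have -> : x + (2 * k%:R - 1) * be = (x + 2 * k%:R * be) - be by ring.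
  by rewrite sinB sinD; ring.
apply: (@mulfI _ (2 * sin be)); first by rewrite mulf_neq0 ?gt_eqF // ltr0n.
rewrite mulr0 mulr_sumr; under eq_bigr do rewrite step.
rewrite -(big_mkord xpredT (fun k => f k.+1 - f k)) telescope_sumr //.
apply/eqP; rewrite subr_eq0 /f; apply/eqP.
have -> : x + (2 * t%:R - 1) * be = x + (2 * 0%:R - 1) * be + pi *+ 2 *+ j.
  by rewrite /be -[_ *+ j]mulr_natr -[pi *+ 2]mulr_natl; field.
by rewrite periodicn //; exact: sinD2pi.
Qed.

End Trigonometry.

(** * Fourier analysis on [Z_t^2] in real form *)

Section Fourier.
Local Open Scope ring_scope.
Variables (R : realType) (n : nat).
Local Notation t := n.+1.
Local Notation Z2 := ('I_t * 'I_t)%type.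
Implicit Types (r s v w : Z2).

(** Argument of the character [r] at [s], computed from representatives in [nat]: it is additive in
    [s] only modulo [2 pi], so the rules below are stated under a cosine. *)
Definition phase r s : R := 2 * pi * (r.1 * s.1 + r.2 * s.2)%N%:R / t%:R.

Lemma cos_phaseD (x : R) r s v :
  cos (x + phase r (s + v)) = cos (x + phase r s + phase r v).
Proof.
pose q := (r.1 * ((s.1 + v.1) %/ t) + r.2 * ((s.2 + v.2) %/ t))%N.
have e : (r.1 * s.1 + r.2 * s.2 + (r.1 * v.1 + r.2 * v.2) =
          r.1 * (s + v)%R.1 + r.2 * (s + v)%R.2 + t * q)%N.
  rewrite /q /=.
  have h1 := divn_eq (s.1 + v.1)%N t; have h2 := divn_eq (s.2 + v.2)%N t.
  transitivity (r.1 * (s.1 + v.1) + r.2 * (s.2 + v.2))%N; first by ring.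
  rewrite [in LHS]h1 [in LHS]h2; ring.
rewrite {1}/phase -(cos_mod x _ e) // /phase natrD; congr cos; ring.
Qed.

Lemma cos_phaseB (x : R) r s v :
  cos (x + phase r (s - v)) = cos (x + phase r s - phase r v).
Proof.
rewrite -[X in cos (_ + phase r X - _)](subrK v s).
by rewrite addrAC [RHS]cos_phaseD; congr cos; ring.
Qed.

(** Orthogonality of characters: if a coordinate of [v] is nonzero, summing over the same coordinate
    of [r] already gives 0. *)
Lemma sum_cos_phase (x : R) v :
  \sum_r cos (x + phase r v) = (v == 0)%:R * (t%:R ^+ 2 * cos x).
Proof.
have [->|v0] := eqVneq v 0.
  rewrite mul1r (eq_bigr (fun=> cos x)) => [|r _].
    by rewrite sumr_const card_prod card_ord -[LHS]mulr_natl natrM expr2.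
  by rewrite /phase /= !muln0 mulr0 mul0r addr0.
rewrite mul0r.
have -> : \sum_r cos (x + phase r v) =
          \sum_(i < t) \sum_(j < t) cos (x + phase (i, j) v).
  by rewrite pair_big /=; apply: eq_bigr => -[].
have [v1|v1] := eqVneq v.1 0.
  have v2 : v.2 != 0 by apply: contra_neq v0 => v2; rewrite [v]surjective_pairing v1 v2.
  apply: big1 => i _.
  rewrite -[RHS](@sum_cos_eq0 R (x + 2 * pi * (i * v.1)%:R / t%:R) t v.2).
    by apply: eq_bigr => j _; congr cos; rewrite /phase /= natrD; ring.
  by rewrite lt0n ltn_ord andbT.
rewrite exchange_big; apply: big1 => j _ /=.
rewrite -[RHS](@sum_cos_eq0 R (x + 2 * pi * (j * v.2)%:R / t%:R) t v.1).
  by apply: eq_bigr => i _; congr cos; rewrite /phase /= natrD; ring.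
by rewrite lt0n ltn_ord andbT.
Qed.

Variable g : Z2 -> R.

Definition autocorr v : R := \sum_s g s * g (s - v).

(** Squared modulus of the Fourier coefficient of [g] at [r], as real part squared plus imaginary
    part squared. *)
Definition spectrum r : R :=
  (\sum_s g s * cos (phase r s)) ^+ 2 + (\sum_s g s * sin (phase r s)) ^+ 2.

Lemma autocorrN v : autocorr (- v) = autocorr v.
Proof.
rewrite /autocorr (reindex_inj (addIr (- v))) /=.
by apply: eq_bigr => s _; rewrite opprK subrK mulrC.
Qed.

(** Wiener-Khinchin: after expanding the squares, [cos a cos b + sin a sin b = cos (a - b)] depends
    only on the difference [v] of the two points. *)
Lemma spectrumE r : spectrum r = \sum_v autocorr v * cos (phase r v).
Proof.
transitivity (\sum_s \sum_s' g s * g s' * cos (phase r s - phase r s')).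
  rewrite /spectrum !expr2 !mulr_suml -big_split /=; apply: eq_bigr => s _.
  rewrite !mulr_sumr -big_split /=; apply: eq_bigr => s' _.
  by rewrite cosB; ring.
under [RHS]eq_bigr do rewrite mulr_suml.
rewrite [RHS]exchange_big; apply: eq_bigr => s _ /=.
rewrite [LHS](reindex_inj (inv_inj (subKr s))) /=; apply: eq_bigr => v _.
congr (_ * _).
rewrite -[X in cos X]add0r addrA -cos_phaseB add0r subKr //.
Qed.

(** Parseval's identity: orthogonality keeps only the term [v = 0] of [spectrumE]. *)
Lemma sum_spectrum : \sum_r spectrum r = t%:R ^+ 2 * autocorr 0.
Proof.
under eq_bigr do rewrite spectrumE.
rewrite exchange_big (bigD1 (0 : Z2)) //= [X in _ + X]big1 ?addr0; last first.
  move=> v /negbTE v0; rewrite -mulr_sumr.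
  under eq_bigr do rewrite -[phase _ _]add0r.
  by rewrite sum_cos_phase v0 mul0r mulr0.
rewrite -mulr_sumr; under eq_bigr do rewrite -[phase _ _]add0r.
by rewrite sum_cos_phase eqxx cos0 mul1r mulr1 mulrC.
Qed.

(** Cosines do not separate [v] from [- v], hence the two terms, which add up when [v = - v]. *)
Lemma sum_cos_cos v w :
  \sum_r cos (phase r v) * cos (phase r w) =
  ((v == w)%:R + (v == - w)%:R) * (t%:R ^+ 2 / 2).
Proof.
have e r : cos (phase r v) * cos (phase r w) =
   (cos (0 + phase r (v - w)) + cos (0 + phase r (v + w))) * 2^-1.
  by rewrite cos_phaseB cos_phaseD !add0r cosB cosD; field.
under eq_bigr do rewrite e.
by rewrite -mulr_suml big_split /= !sum_cos_phase subr_eq0 addr_eq0 cos0; field.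
Qed.

(** Parseval for the autocorrelation: it turns the sum defining uniformity into the fourth moment of
    the Fourier transform. Both terms of [sum_cos_cos] contribute equally because [autocorr] is
    even. *)
Lemma sum_spectrum_sqr :
  \sum_r spectrum r ^+ 2 = t%:R ^+ 2 * \sum_v autocorr v ^+ 2.
Proof.
have e v : \sum_r spectrum r * cos (phase r v) = t%:R ^+ 2 * autocorr v.
  under eq_bigr do rewrite spectrumE mulr_suml.
  rewrite exchange_big /=.
  have e2 w : \sum_r autocorr w * cos (phase r w) * cos (phase r v) =
     (if w == v then autocorr w * (t%:R ^+ 2 / 2) else 0) +
     (if w == - v then autocorr w * (t%:R ^+ 2 / 2) else 0).
    under eq_bigr do rewrite -mulrA.
    rewrite -mulr_sumr sum_cos_cos.
    by case: (w == v); case: (w == - v); rewrite /= ?mul0r ?mul1r; ring.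
  under eq_bigr do rewrite e2.
  by rewrite big_split /= -!big_mkcond /= !big_pred1_eq autocorrN; field.
under eq_bigr do rewrite expr2 {2}spectrumE mulr_sumr.
rewrite exchange_big mulr_sumr; apply: eq_bigr => v _ /=.
transitivity (autocorr v * \sum_r spectrum r * cos (phase r v)).
  by rewrite mulr_sumr; apply: eq_bigr => r _; ring.
by rewrite e; ring.
Qed.

End Fourier.

(** * Non-uniform sets correlate with a character *)

Section NonUniformity.
Local Open Scope ring_scope.
Variables (R : realType) (n : nat).
Local Notation t := n.+1.
Local Notation Z2 := ('I_t * 'I_t)%type.
Variable S : {set Z2}.

Lemma sum_balanced_sqr :
  let eta : R := #|S|%:R / t%:R ^+ 2 in
  \sum_s balanced R S s ^+ 2 = t%:R ^+ 2 * (eta * (1 - eta)).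
Proof.
move=> eta.
have t0 : t%:R != 0 :> R by rewrite pnatr_eq0.
have e s : balanced R S s ^+ 2 = (s \in S)%:R * (1 - 2 * eta) + eta ^+ 2.
  by rewrite /balanced -/eta; case: (s \in S) => /=; ring.
under eq_bigr do rewrite e.
rewrite big_split /= -mulr_suml sumr_const card_prod card_ord.
have -> : \sum_s (s \in S)%:R = #|S|%:R :> R.
  by rewrite -sumr_const [RHS]big_mkcond; apply: eq_bigr => s _; case: (s \in S).
rewrite -[_ *+ (t * t)]mulr_natl natrM.
have -> : #|S|%:R = eta * t%:R ^+ 2 by rewrite /eta divfK // expf_neq0.
ring.
Qed.

Lemma autocorr0_le : autocorr (balanced R S) 0 <= t%:R ^+ 2 / 4.
Proof.
have -> : autocorr (balanced R S) 0 = \sum_s balanced R S s ^+ 2.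
  by apply: eq_bigr => s _; rewrite subr0 expr2.
rewrite sum_balanced_sqr; set eta := (X in X * (1 - X)).
apply: ler_wpM2l; first exact: exprn_ge0.
by have := sqr_ge0 (eta - 2^-1); nra.
Qed.

(** Termwise [|a b| <= a ^ 2 / 2 + b ^ 2 / 2], and translation by [v] preserves the sum of
    squares. *)
Lemma autocorr_le v : `|autocorr (balanced R S) v| <= t%:R ^+ 2 / 4.
Proof.
apply: le_trans autocorr0_le.
have e0 : autocorr (balanced R S) 0 =
    \sum_s (balanced R S s ^+ 2 / 2 + balanced R S (s - v) ^+ 2 / 2).
  rewrite big_split /= -[X in _ = _ + X](reindex_inj (addIr (- v)) (P := xpredT)
    (F := fun s => balanced R S s ^+ 2 / 2)) /= -big_split /=.
  by apply: eq_bigr => s _; rewrite subr0; field.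
rewrite e0; apply: le_trans (ler_norm_sum _ _ _) _; apply: ler_sum => s _.
rewrite ler_norml; apply/andP.
have := sqr_ge0 (balanced R S s - balanced R S (s - v)).
have := sqr_ge0 (balanced R S s + balanced R S (s - v)).
by split; nra.
Qed.

(** Each of the [t ^ 2] autocorrelations is at most [t ^ 2 / 4], so their squares sum to at most
    [t ^ 6 / 16]. This settles the range of large alpha. *)
Lemma uniform_large (gamma : R) : 16^-1 <= gamma -> uniform gamma S.
Proof.
move=> hg; rewrite /uniform.
apply: (@le_trans _ _ (\sum_(v : Z2) (t%:R ^+ 2 / 4) ^+ 2)).
  apply: ler_sum => v _; rewrite -!/(autocorr _ _).
  by rewrite ler_sqr ?nnegrE ?normr_ge0 ?autocorr_le // divr_ge0 ?exprn_ge0.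
rewrite sumr_const card_prod card_ord -[leLHS]mulr_natl natrM.
have -> : t%:R * t%:R * (t%:R ^+ 2 / 4) ^+ 2 = 16^-1 * t%:R ^+ 6 :> R by field.
by apply: ler_wpM2r hg; exact: exprn_ge0.
Qed.

(** Otherwise [x = 0] and [x = - pi / 2] bound the real and imaginary parts, so every value of
    [spectrum] is at most [4 gamma t ^ 4]. Its squares then sum to at most [4 gamma t ^ 4] times the
    Parseval sum, itself at most [t ^ 4 / 4], and this is uniformity. *)
Lemma nonuniform_character (gamma : R) : 0 <= gamma -> ~ uniform gamma S ->
  exists (r : Z2) (x : R),
    2 * gamma * t%:R ^+ 4 <= (\sum_s balanced R S s * cos (x + phase R r s)) ^+ 2.
Proof.
move=> g0 nu; apply: contrapT => /forallNP H; apply: nu.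
set g := balanced R S.
have tp : 0 < t%:R :> R by rewrite ltr0n.
have sp r : spectrum g r <= 4 * gamma * t%:R ^+ 4.
  have /forallNP Hr := H r.
  have /negP := Hr 0; rewrite -ltNge => h1.
  have /negP := Hr (- (pi / 2)); rewrite -ltNge => h2.
  move: h1; under eq_bigr do rewrite add0r; move=> h1.
  move: h2; under eq_bigr do rewrite addrC cosBpihalf; move=> h2.
  by rewrite /spectrum /g; apply: le_trans (ltW (ltrD h1 h2)) _; lra.
have sp0 r : 0 <= spectrum g r by rewrite addr_ge0 ?sqr_ge0.
rewrite /uniform.
have -> : \sum_(v : Z2) `|\sum_(s : Z2) balanced R S s * balanced R S (s - v)| ^+ 2 =
          \sum_v autocorr g v ^+ 2.
  by apply: eq_bigr => v _; rewrite real_normK ?num_real.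
rewrite -(ler_pM2l (exprn_gt0 2 tp)) -sum_spectrum_sqr.
apply: (@le_trans _ _ (\sum_r 4 * gamma * t%:R ^+ 4 * spectrum g r)).
  by apply: ler_sum => r _; rewrite expr2 ler_wpM2r.
rewrite -mulr_sumr sum_spectrum.
have -> : t%:R ^+ 2 * (gamma * t%:R ^+ 6) =
  4 * gamma * t%:R ^+ 4 * (t%:R ^+ 2 * (t%:R ^+ 2 / 4)) :> R by field.
apply: ler_wpM2l; first by rewrite !mulr_ge0 ?exprn_ge0.
by apply: ler_wpM2l; rewrite ?exprn_ge0 ?autocorr0_le.
Qed.

End NonUniformity.

(** * Coordinates and counting in right squares *)

Section Squares.
Local Open Scope ring_scope.

(** Inverse of [rs_phi]; natural arguments make it easy to express points of a subsquare in the
    coordinates of the larger one. *)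
Definition rs_point (P : right_square) (k l : nat) : nat * nat :=
  (rs_a P + k * rs_d P, rs_b P + l * rs_d P)%N.

Lemma arith_progP (a d t x : nat) :
  reflect (exists2 k, (k < t)%N & x = (a + k * d)%N) (x \in arith_prog a d t).
Proof.
apply: (iffP (imfsetP _ _ _ _)) => -[k kt ->]; exists k => //.
  by have : k \in iota 0 t := kt; rewrite mem_iota.
by have : k \in iota 0 t by rewrite mem_iota.
Qed.

Lemma rs_setP (P : right_square) (x : nat * nat) :
  reflect (exists2 k, (k < rs_len P)%N & exists2 l, (l < rs_len P)%N &
             x = rs_point P k l)
    (x \in rs_set P).
Proof.
rewrite /rs_set in_fsetM; apply: (iffP andP).
  case: x => x1 x2 /= [/arith_progP[k kt ->] /arith_progP[l lt ->]].
  by exists k => //; exists l.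
move=> [k kt [l lt ->]].
by split; apply/arith_progP; [exists k|exists l].
Qed.

Lemma rs_point_inj (P : right_square) (k l k' l' : nat) :
  rs_point P k l = rs_point P k' l' -> k = k' /\ l = l'.
Proof.
have d0 := rs_d_gt0 P.
move=> [/addnI/eqP + /addnI/eqP].
by rewrite !eqn_pmul2r // => /eqP -> /eqP ->.
Qed.

Lemma in_rs_image (P : right_square) (W : {fset nat * nat})
    (s : 'I_(rs_len1 P).+1 * 'I_(rs_len1 P).+1) :
  (s \in rs_image P W) = (rs_point P s.1 s.2 \in W).
Proof.
rewrite /rs_image inE; apply/mapP/idP.
  move=> [x]; rewrite in_fsetI => /andP[xW /rs_setP[k kt [l lt ex]]] ->.
  have -> : rs_phi P x = (Ordinal kt, Ordinal lt).
    by rewrite ex -[in RHS](rs_phiE (Ordinal kt) (Ordinal lt)).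
  by rewrite /= -ex.
move=> sW; exists (rs_point P s.1 s.2).
  rewrite in_fsetI sW; apply/rs_setP.
  by exists s.1; rewrite ?ltn_ord //; exists s.2; rewrite ?ltn_ord.
by rewrite rs_phiE -surjective_pairing.
Qed.

Lemma card_fsetI_rs_set (P : right_square) (W : {fset nat * nat}) :
  #|` W `&` rs_set P| = #|rs_image P W|.
Proof.
rewrite cardE -[RHS](size_map (fun s : 'I_(rs_len1 P).+1 * 'I_(rs_len1 P).+1 => rs_point P s.1 s.2)).
apply: (@perm_size _ (enum_fset (W `&` rs_set P))); apply: uniq_perm => [|| x].
- exact: fset_uniq.
- rewrite map_inj_uniq ?enum_uniq // => -[k l] [k' l'] /= /rs_point_inj[e1 e2].
  by congr pair; apply: val_inj.
rewrite in_fsetI; apply/andP/mapP.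
  move=> [xW /rs_setP[k kt [l lt ex]]]; exists (Ordinal kt, Ordinal lt) => //.
  by rewrite mem_enum in_rs_image -ex.
move=> [s]; rewrite mem_enum in_rs_image => sW ->; split=> //; apply/rs_setP.
by exists s.1; rewrite ?ltn_ord //; exists s.2; rewrite ?ltn_ord.
Qed.

Lemma card_rs_set (P : right_square) : #|` rs_set P| = (rs_len P ^ 2)%N.
Proof.
rewrite -{1}[rs_set P]fsetIid card_fsetI_rs_set.
have -> : rs_image P (rs_set P) = finset.setT.
  apply/setP => s; rewrite in_rs_image [RHS]inE; apply/rs_setP.
  by exists s.1; rewrite ?ltn_ord //; exists s.2; rewrite ?ltn_ord.
by rewrite cardsT card_prod card_ord.
Qed.

End Squares.

(** * Simultaneous Diophantine approximation *)

Section Dirichlet.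
Local Open Scope ring_scope.

(** Pigeonhole: among [Q ^ 2 + 1] multipliers [k], two put [(k r1, k r2)] modulo [t] into the same
    of [Q ^ 2] boxes of side [t / Q]; [d] is their difference. The integers approximating [d r / t]
    are written [p - q] with [p] and [q] natural. *)
Lemma dirichlet_pair (R : realFieldType) (t Q r1 r2 : nat) : (0 < t)%N -> (0 < Q)%N ->
  exists (d p1 q1 p2 q2 : nat), [/\ (0 < d <= Q ^ 2)%N,
    `|d%:R * r1%:R + q1%:R * t%:R - p1%:R * t%:R : R| * Q%:R <= t%:R &
    `|d%:R * r2%:R + q2%:R * t%:R - p2%:R * t%:R : R| * Q%:R <= t%:R].
Proof.
move=> t0 Q0.
have bnd k r : ((k * r) %% t * Q %/ t < Q)%N.
  by rewrite ltn_divLR // mulnC ltn_pmul2l // ltn_mod.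
pose box (k : 'I_(Q ^ 2).+1) := (Ordinal (bnd k r1), Ordinal (bnd k r2)).
have /injectivePn[k [k' nkk' eb]] : ~~ injectiveb box.
  apply/negP => /injectiveP/leq_card.
  by rewrite card_prod !card_ord ltnn.
wlog lt_kk' : k k' nkk' eb / (k < k')%N.
  move=> hw; have [lt|lt|/val_inj e] := ltngtP k k'.
  - exact: (hw k k').
  - by apply: (hw k' k); rewrite // eq_sym.
  - by rewrite e eqxx in nkk'.
have close r : ((k * r) %% t * Q %/ t = (k' * r) %% t * Q %/ t)%N ->
  `|(k' - k)%N%:R * r%:R + (k * r %/ t)%N%:R * t%:R - (k' * r %/ t)%N%:R * t%:R : R|
    * Q%:R <= t%:R.
  move=> e.
  have -> : (k' - k)%N%:R * r%:R + (k * r %/ t)%N%:R * t%:R - (k' * r %/ t)%N%:R * t%:R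
     = ((k' * r) %% t)%N%:R - ((k * r) %% t)%N%:R :> R.
    rewrite natrB 1?ltnW // mulrBl -!natrM.
    by rewrite {1}(divn_eq (k' * r) t) {1}(divn_eq (k * r) t) !natrD !natrM; ring.
  rewrite -[Q%:R]normr_nat -normrM mulrBl -!natrM.
  have h1 := divn_eq ((k * r) %% t * Q) t.
  have h2 := divn_eq ((k' * r) %% t * Q) t.
  have h3 : ((k * r) %% t * Q %% t < t)%N by rewrite ltn_mod.
  have h4 : ((k' * r) %% t * Q %% t < t)%N by rewrite ltn_mod.
  rewrite h1 h2 e !natrD.
  rewrite ler_norml; apply/andP; move: h3 h4; rewrite -!(ltr_nat R).
  set u := (X in X < _ -> _); set v := (X in _ -> X < _ -> _).
  have : 0 <= u by []. have : 0 <= v by [].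
  by split; lra.
exists (k' - k)%N, (k' * r1 %/ t)%N, (k * r1 %/ t)%N, (k' * r2 %/ t)%N, (k * r2 %/ t)%N.
case: eb => e1 e2; split; [|exact: close|exact: close].
by rewrite subn_gt0 lt_kk' /= (leq_trans (leq_subr _ _)) // -ltnS.
Qed.

End Dirichlet.

(** * From correlation to an energy increment *)

Section EnergyIncrement.
Local Open Scope ring_scope.

Lemma sqr_sum_le_card (R : realFieldType) (T : finType) (a : T -> R) :
  (\sum_c a c) ^+ 2 <= #|T|%:R * \sum_c a c ^+ 2.
Proof.
have -> : #|T|%:R * \sum_c a c ^+ 2 = \sum_c \sum_c' (a c ^+ 2 / 2 + a c' ^+ 2 / 2).
  under [RHS]eq_bigr do rewrite big_split /= sumr_const.
  by rewrite big_split /= sumr_const sumrMnl -!mulr_suml -[in RHS]mulr_natl; field.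
rewrite expr2 mulr_suml; apply: ler_sum => c _.
rewrite mulr_sumr; apply: ler_sum => c' _.
by have := sqr_ge0 (a c - a c'); nra.
Qed.

(* If [f - eta] correlates with [h] and [h] is almost constant on the tiles, then
   [f - eta] has large mean on many tiles; Cauchy-Schwarz turns this into an
   increment of the mean square density. *)
Lemma energy_increment (R : realFieldType) (Z T J : finType) (phi : T * J -> Z)
    (f h : Z -> R) (hc : T -> R) (e gamma : R) :
  injective phi -> (0 < #|J|)%N -> 0 <= e ->
  (forall s, 0 <= f s <= 1) -> (forall s, `|h s| <= 1) ->
  (forall c, `|hc c| <= 1) ->
  (forall c j, `|h (phi (c, j)) - hc c| <= e) ->
  let n : R := #|Z|%:R in
  let eta := (\sum_s f s) / n in
  2 * gamma * n ^+ 2 <= (\sum_s (f s - eta) * h s) ^+ 2 ->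
  (\sum_s f s) ^+ 2 / n + (2 * gamma - 2 * e) * n - 4 * (n - #|T|%:R * #|J|%:R)
   <= \sum_c (\sum_j f (phi (c, j))) ^+ 2 / #|J|%:R.
Proof.
move=> phi_inj J0 e0 f01 h1 hc1 hhc n eta big.
have M0 : 0 < #|J|%:R :> R by rewrite ltr0n.
set M : R := #|J|%:R in M0 *; set q : R := #|T|%:R.
have q0 : 0 <= q by [].
set D := [set phi x | x in [set: T * J]]%SET.
have cardD : #|D|%:R = q * M.
  by rewrite /D card_imset // cardsT card_prod natrM.
have cardDC : #|~: D|%:R = n - q * M.
  by rewrite -cardD /n -(cardsC D) natrD addrAC subrr add0r.
set l := n - q * M in cardDC *.
have l0 : 0 <= l by rewrite -cardDC.
have split_sum (F : Z -> R) :
    \sum_s F s = \sum_c \sum_j F (phi (c, j)) + \sum_(s in ~: D) F s.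
  rewrite (bigID (mem D)) /=; congr (_ + _).
    rewrite /D big_imset /=; last by move=> x y _ _; exact: phi_inj.
    by rewrite pair_big /=; apply: eq_big => [[c j]|[c j] _] //; rewrite inE.
  by apply: eq_bigl => s; rewrite inE.
have [Z0|Z0] := posnP #|Z|.
  have n0 : n = 0 by rewrite /n Z0.
  have qM0 : q = 0.
    have : q * M <= 0 by move: l0; rewrite /l n0; lra.
    by move: q0 M0; nra.
  rewrite n0 /l n0 qM0 invr0 !mulr0 mul0r subr0 addr0 mulr0 subr0.
  by apply: sumr_ge0 => c _; rewrite divr_ge0 ?sqr_ge0 // ltW.
have n0 : 0 < n by rewrite /n ltr0n.
have sumf : \sum_s f s = eta * n by rewrite /eta divfK // gt_eqF.
have eta01 : 0 <= eta <= 1.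
  rewrite /eta divr_ge0 ?sumr_ge0 //=; last by move=> s _; case/andP: (f01 s).
  rewrite ler_pdivrMr // mul1r /n -sumr_const.
  by apply: ler_sum => s _; case/andP: (f01 s).
pose g s : R := f s - eta.
have g1 s : `|g s| <= 1.
  by rewrite ler_norml /g; move: (f01 s) eta01 => /andP[? ?] /andP[? ?]; lra.
pose w c := \sum_j f (phi (c, j)).
pose G c := \sum_j g (phi (c, j)).
have GE c : G c = w c - eta * M.
  by rewrite /G sumrB sumr_const -[eta *+ _]mulr_natr.
set X := `|\sum_s g s * h s|.
set Y := \sum_c `|G c|.
have X0 : 0 <= X := normr_ge0 _.
have Y0 : 0 <= Y by apply: sumr_ge0 => c _; exact: normr_ge0.
have gh1 s : `|g s * h s| <= 1 by rewrite normrM mulr_ile1.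
have Xn : X <= n.
  apply: le_trans (ler_norm_sum _ _ _) _; rewrite /n -sumr_const.
  by apply: ler_sum => s _; exact: gh1.
(* Replacing [h] by the constant [hc c] on a tile costs at most [e] per point, as [|g| <= 1]. *)
have tile c : `|\sum_j g (phi (c, j)) * h (phi (c, j))| <= `|G c| + e * M.
  have -> : \sum_j g (phi (c, j)) * h (phi (c, j)) =
     G c * hc c + \sum_j g (phi (c, j)) * (h (phi (c, j)) - hc c).
    by rewrite /G mulr_suml -big_split /=; apply: eq_bigr => j _; ring.
  apply: le_trans (ler_normD _ _) _; apply: lerD.
    by rewrite normrM ler_piMr.
  apply: le_trans (ler_norm_sum _ _ _) _.
  rewrite /M mulr_natr -sumr_const; apply: ler_sum => j _.
  by rewrite normrM; apply: le_trans (hhc c j); rewrite ler_piMl.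
have XY : X <= Y + (e * n + l).
  rewrite /X split_sum; apply: le_trans (ler_normD _ _) _.
  have -> : Y + (e * n + l) = (Y + e * (q * M)) + (e * l + l) by rewrite /l; ring.
  apply: lerD.
    apply: le_trans (ler_norm_sum _ _ _) _.
    apply: (@le_trans _ _ (\sum_c (`|G c| + e * M))); first by apply: ler_sum.
    by rewrite big_split /= sumr_const -[_ *+ #|_|]mulr_natr -/q /Y mulrAC mulrA lexx.
  apply: (@le_trans _ _ l); last by rewrite lerDr mulr_ge0.
  apply: le_trans (ler_norm_sum _ _ _) _; rewrite -cardDC -sumr_const.
  by apply: ler_sum.
have X2 : 2 * gamma * n ^+ 2 <= X ^+ 2 by rewrite real_normK ?num_real.
have k0 : 0 <= e * n + l by rewrite addr_ge0 ?mulr_ge0 // ltW.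
(* Squaring [X <= Y + k] loses at most [2 X k], and [X <= n]. *)
have Y2 : 2 * gamma * n ^+ 2 - 2 * n * (e * n + l) <= Y ^+ 2.
  set k := e * n + l in XY k0 *.
  have h2 : X ^+ 2 - 2 * X * k <= Y ^+ 2.
    have [lXk|lkX] := lerP X k; first by move: X0 Y0 k0; nra.
    have : (X - k) ^+ 2 <= Y ^+ 2.
      by rewrite ler_sqr ?nnegrE ?subr_ge0 ?(ltW lkX) //; lra.
    by have := sqr_ge0 k; lra.
  have : X * k <= n * k by apply: ler_wpM2r.
  lra.
have Ycs : Y ^+ 2 <= q * \sum_c G c ^+ 2.
  apply: le_trans (sqr_sum_le_card _) _; rewrite ler_wpM2l //.
  by apply: ler_sum => c _; rewrite real_normK ?num_real.
set SG := \sum_c G c ^+ 2 in Ycs.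
have SG0 : 0 <= SG by apply: sumr_ge0 => c _; exact: sqr_ge0.
have YM : Y ^+ 2 * M <= n * SG.
  apply: (@le_trans _ _ (q * SG * M)); first by rewrite ler_wpM2r // ltW.
  by rewrite mulrAC ler_wpM2r // -subr_ge0.
have sumw : eta * n - l <= \sum_c w c.
  rewrite -sumf split_sum -/w lerBlDr lerD2l -cardDC -sumr_const.
  by apply: ler_sum => s _; case/andP: (f01 s).
(* Variance decomposition: expand the square of [G c = w c - eta M]. *)
have -> : \sum_c (\sum_j f (phi (c, j))) ^+ 2 / M =
    SG / M + 2 * eta * \sum_c w c - eta ^+ 2 * (q * M).
  have -> : eta ^+ 2 * (q * M) = \sum_(c : T) eta ^+ 2 * M.
    by rewrite sumr_const -[RHS]mulr_natr -/q; ring.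
  rewrite /SG mulr_suml mulr_sumr -big_split -sumrB /=; apply: eq_bigr => c _.
  by rewrite GE -/(w c); field; rewrite gt_eqF.
have -> : (\sum_s f s) ^+ 2 / n = eta ^+ 2 * n.
  by rewrite sumf; field; rewrite gt_eqF.
have SGM : Y ^+ 2 / n <= SG / M.
  by rewrite ler_pdivrMr // mulrAC ler_pdivlMr // [leRHS]mulrC.
have Yn : (2 * gamma - 2 * e) * n - 2 * l <= Y ^+ 2 / n.
  by rewrite ler_pdivlMr //; move: Y2; lra.
have qMn : q * M <= n by rewrite -subr_ge0.
have e2 : eta ^+ 2 * (q * M) <= eta ^+ 2 * n by rewrite ler_wpM2l ?sqr_ge0.
case/andP: eta01 => eta0 eta1.
have e3 : eta * (eta * n - l) <= eta * \sum_c w c by rewrite ler_wpM2l.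
have e4 : eta * l <= l by rewrite ler_piMl.
(* The loss [4 l] is [2 l] from [Yn] plus [2 l] from the cross term [2 eta \sum_c w c]. *)
rewrite expr2 in e2 *; lra.
Qed.

End EnergyIncrement.

(** * Cutting a non-uniform square into smaller right squares *)

Section Tiling.
Local Open Scope ring_scope.

(* The [j]-th term of the [x]-th block, [x < d * u], when [0, d * m * u) is cut
   into residue classes mod [d] and each class into [u] blocks of length [m]. *)
Definition block_index (d m x j : nat) : nat :=
  (x %% d + d * (m * (x %/ d) + j))%N.

Lemma block_index_lt (d m u x j : nat) : (x < d * u)%N -> (j < m)%N ->
  (block_index d m x j < d * m * u)%N.
Proof.
move=> xlt jm; have d0 : (0 < d)%N by case: d xlt.
have r : (x %% d < d)%N by rewrite ltn_mod.
have q : (x %/ d < u)%N by rewrite ltn_divLR // mulnC.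
rewrite /block_index; apply: (@leq_trans (d * (m * (x %/ d) + j).+1)); first by lia.
rewrite -mulnA leq_mul2l; apply/orP; right.
by apply: (@leq_trans (m * (x %/ d).+1)); [lia|rewrite leq_mul2l q orbT].
Qed.

Lemma block_index_inj (d m x j x' j' : nat) : (0 < d)%N -> (j < m)%N -> (j' < m)%N ->
  block_index d m x j = block_index d m x' j' -> x = x' /\ j = j'.
Proof.
move=> d0 jm jm' e.
have m0 : (0 < m)%N by case: m jm {jm' e}.
have em : (x %% d = x' %% d)%N.
  have /(congr1 (modn^~ d)) := e.
  by rewrite /= /block_index ![(_ %% _ + d * _)%N]addnC ![(d * _)%N]mulnC !modnMDl !modn_mod.
have : (m * (x %/ d) + j = m * (x' %/ d) + j')%N.
  by move: e; rewrite /block_index em => /addnI/eqP; rewrite eqn_pmul2l // => /eqP.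
rewrite ![(m * _)%N]mulnC => e2.
have ej : j = j'.
  by have /(congr1 (modn^~ m)) := e2; rewrite /= !modnMDl !modn_small.
split=> //; rewrite (divn_eq x d) (divn_eq x' d) em; congr (_ * _ + _)%N.
by apply/eqP; rewrite -(eqn_pmul2r m0) -(eqn_add2r j) {2}ej e2.
Qed.

(** Product of the [x]-th and [y]-th blocks; using the same [d] in both directions keeps it a right
    square. *)
Definition block_square (P : right_square) (d : nat) (d_gt0 : (0 < d)%N) (m1 x y : nat)
    : right_square :=
  @RightSquare (rs_a P + block_index d m1.+1 x 0 * rs_d P)%N
    (rs_b P + block_index d m1.+1 y 0 * rs_d P)%N (rs_d P * d)%N m1
    (eq_ind_r is_true (introT andP (conj (rs_d_gt0 P) d_gt0)) (muln_gt0 _ _)).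

Lemma block_squareE (P : right_square) (d : nat) (d_gt0 : (0 < d)%N) (m1 x y k l : nat) :
  rs_point (block_square P d_gt0 m1 x y) k l =
  rs_point P (block_index d m1.+1 x k) (block_index d m1.+1 y l).
Proof.
rewrite /rs_point /block_square /block_index; cbn [rs_a rs_b rs_d].
congr pair; ring.
Qed.

Definition energy (R : realType) (W : {fset nat * nat}) (P : right_square) : R :=
  #|` W `&` rs_set P|%:R ^+ 2 / #|` rs_set P|%:R.

Lemma card_fsetI_rs_set_sum (R : realType) (W : {fset nat * nat}) (P : right_square) :
  #|` W `&` rs_set P|%:R =
  \sum_(s : 'I_(rs_len1 P).+1 * 'I_(rs_len1 P).+1) (rs_point P s.1 s.2 \in W)%:R :> R.
Proof.
rewrite card_fsetI_rs_set -sumr_const big_mkcond /=; apply: eq_bigr => s _.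
by rewrite in_rs_image; case: ifP.
Qed.

(** Dirichlet with [Q = m ^ 2] gives [d <= m ^ 4] such that fewer than [m] steps of [d] in each
    direction turn the character by at most [2 pi (1 / m + 1 / m) <= 16 / m]. Blocks span
    [d m <= m ^ 5] consecutive indices, little compared with the side [t >= m ^ 8], so the tiles
    miss a proportion of at most [2 / m ^ 3]. *)
Lemma split_square (R : realType) (gamma : R) (W : {fset nat * nat})
    (P : right_square) (m : nat) :
  (0 < m)%N -> (m ^ 8 <= rs_len P)%N -> 0 <= gamma -> ~ uniform_in gamma W P ->
  exists L : seq right_square,
    [/\ forall x, (\sum_(C <- L) (x \in rs_set C) <= (x \in rs_set P))%N,
        all (fun C => rs_len C == m) L,
        (1 - 2 / m%:R ^+ 3) * #|` rs_set P|%:R <= \sum_(C <- L) #|` rs_set C|%:R :> R &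
        energy R W P + (2 * gamma - 40 / m%:R) * #|` rs_set P|%:R <=
          \sum_(C <- L) energy R W C].
Proof.
case: m => // m1 _; set m := m1.+1 => mt g0 nu.
set t := rs_len P in mt *.
have t0 : (0 < t)%N by [].
have [r [x0 big]] := nonuniform_character g0 nu.
have Q0 : (0 < m ^ 2)%N by rewrite expn_gt0.
have [d [p1 [q1 [p2 [q2 [/andP[d0 dQ] h1 h2]]]]]] :=
  @dirichlet_pair R t (m ^ 2) r.1 r.2 t0 Q0.
rewrite -expnM in dQ.
have dm0 : (0 < d * m)%N by rewrite muln_gt0 d0.
have dm5 : (d * m <= m ^ 5)%N by rewrite [X in (_ <= X)%N]expnSr leq_mul2r dQ orbT.
pose u := (t %/ (d * m))%N; pose U := (d * u)%N.
have ut : (d * m * u <= t)%N by rewrite mulnC leq_trunc_div.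
have tu : (t < d * m * u + d * m)%N.
  by rewrite {1}(divn_eq t (d * m)) mulnC ltn_add2l ltn_mod.
have ltt (x : 'I_U) (j : 'I_m) : (block_index d m x j < t)%N.
  by apply: leq_trans ut; exact: block_index_lt.
pose phi (z : ('I_U * 'I_U) * ('I_m * 'I_m)) : 'I_(rs_len1 P).+1 * 'I_(rs_len1 P).+1 :=
  (inord (block_index d m z.1.1 z.2.1), inord (block_index d m z.1.2 z.2.2)).
have phi1 z : (phi z).1 = block_index d m z.1.1 z.2.1 :> nat by rewrite inordK ?ltt.
have phi2 z : (phi z).2 = block_index d m z.1.2 z.2.2 :> nat by rewrite inordK ?ltt.
have phi_inj : injective phi.
  move=> z z' e.
  have := phi1 z; rewrite e phi1 => /esym/(block_index_inj d0 (ltn_ord _) (ltn_ord _))[e1 e2].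
  have := phi2 z; rewrite e phi2 => /esym/(block_index_inj d0 (ltn_ord _) (ltn_ord _))[e3 e4].
  case: z z' e1 e2 e3 e4 {e} => [[? ?] [? ?]] [[? ?] [? ?]] /= *.
  by congr ((_, _), (_, _)); apply: val_inj.
pose C (c : 'I_U * 'I_U) := block_square P d0 m1 c.1 c.2.
have CE c (j : 'I_m * 'I_m) : rs_point (C c) j.1 j.2 = rs_point P (phi (c, j)).1 (phi (c, j)).2.
  by rewrite phi1 phi2 block_squareE.
exists [seq C c | c <- enum {: 'I_U * 'I_U}].
have mp : 0 < m%:R :> R by rewrite ltr0n.
have tp : 0 < t%:R :> R by rewrite ltr0n.
(* Fewer than [d m <= m ^ 5] indices are lost in each direction, and [m ^ 5 <= t / m ^ 3]. *)
have cov : t%:R ^+ 2 - 2 * t%:R ^+ 2 / m%:R ^+ 3 <= (d * m * u)%:R ^+ 2 :> R.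
  set v : R := (d * m * u)%:R.
  have hv : t%:R - m%:R ^+ 5 <= v.
    rewrite lerBlDr -natrX -natrD ler_nat; apply: leq_trans (ltnW tu) _.
    by rewrite leq_add2l.
  have hm : t%:R * m%:R ^+ 5 <= t%:R ^+ 2 / m%:R ^+ 3 :> R.
    rewrite ler_pdivlMr ?exprn_gt0 // -mulrA -exprD expr2 ler_pM2l //.
    by rewrite -natrX ler_nat.
  have v0 : 0 <= v by [].
  have m5 : 0 <= m%:R ^+ 5 :> R by rewrite exprn_ge0.
  have : t%:R ^+ 2 - 2 * t%:R * m%:R ^+ 5 <= v ^+ 2.
    move: hv hm m5; set k := m%:R ^+ 5 => hv hm m5.
    have [lk|lk] := lerP k t%:R; last by have := sqr_ge0 v; nra.
    have : (t%:R - k) ^+ 2 <= v ^+ 2 by rewrite ler_sqr ?nnegrE ?subr_ge0.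
    by have := sqr_ge0 k; lra.
  by lra.
have cardC : #|{: 'I_U * 'I_U}|%:R * #|{: 'I_m * 'I_m}|%:R = (d * m * u)%:R ^+ 2 :> R.
  by rewrite !card_prod !card_ord /U -natrM -natrX; congr _%:R; ring.
split.
- move=> x; rewrite big_map big_enum /=.
  have inC c : x \in rs_set (C c) ->
      exists j, x = rs_point P (phi (c, j)).1 (phi (c, j)).2.
    move=> /rs_setP[k km [l lm ->]].
    by exists (Ordinal (km : (k < m)%N), Ordinal (lm : (l < m)%N)); rewrite -CE.
  have [[c xc]|nC] := pselect (exists c, x \in rs_set (C c)); last first.
    by rewrite big1 // => c _; case xc: (x \in _) => //; case: nC; exists c.
  have [j ej] := inC c xc.
  have -> : x \in rs_set P.
    rewrite ej; apply/rs_setP; exists (phi (c, j)).1; first exact: ltn_ord.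
    by exists (phi (c, j)).2; first exact: ltn_ord.
  rewrite (bigD1 c) //= xc [X in (_ + X)%N]big1 ?addn0 // => c' /eqP nc; case xc': (x \in _) => //.
  have [j' ej'] := inC c' xc'; case: nc.
  have [e1 e2] := rs_point_inj (etrans (esym ej') ej).
  have : phi (c', j') = phi (c, j).
    by rewrite [LHS]surjective_pairing [RHS]surjective_pairing; congr pair; apply: val_inj.
  by move=> /phi_inj[].
- by rewrite all_map; apply/allP => c _ /=; rewrite /rs_len eqxx.
- rewrite big_map big_enum /= (eq_bigr (fun=> m%:R ^+ 2)); last first.
    by move=> c _; rewrite card_rs_set natrX.
  rewrite card_rs_set -/t natrX.
  rewrite sumr_const -[leRHS]mulr_natl.
  have -> : m%:R ^+ 2 = #|{: 'I_m * 'I_m}|%:R :> R by rewrite card_prod card_ord natrM expr2.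
  by rewrite cardC; apply: le_trans cov; rewrite mulrBl mul1r mulrAC.
pose f (s : 'I_(rs_len1 P).+1 * 'I_(rs_len1 P).+1) : R := (rs_point P s.1 s.2 \in W)%:R.
pose h s : R := cos (x0 + phase R r s).
pose hc c := h (phi (c, (ord0, ord0))).
have Mm : #|{: 'I_m * 'I_m}|%:R = m%:R ^+ 2 :> R by rewrite card_prod card_ord natrM expr2.
have Nt : #|{: 'I_(rs_len1 P).+1 * 'I_(rs_len1 P).+1}|%:R = t%:R ^+ 2 :> R.
  by rewrite card_prod card_ord natrM expr2.
have f01 s : 0 <= f s <= 1 by rewrite /f; case: (_ \in W); rewrite /= ?lexx ?ler01.
have h1' s : `|h s| <= 1 by exact: cos_max.
have hhc c j : `|h (phi (c, j)) - hc c| <= 16 / m%:R.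
  have split_ix x k : block_index d m x k = (block_index d m x 0 + k * d)%N.
    by rewrite /block_index; ring.
  set b1 := block_index d m c.1 0; set b2 := block_index d m c.2 0.
  set A := (r.1 * b1 + r.2 * b2)%N.
  have -> : hc c = cos (x0 + 2 * pi * A%:R / t%:R) by rewrite /hc /h /phase phi1 phi2.
  set e1 : R := d%:R * r.1%:R + q1%:R * t%:R - p1%:R * t%:R.
  set e2 : R := d%:R * r.2%:R + q2%:R * t%:R - p2%:R * t%:R.
  (* Both sides are shifted by whole periods, by the [q] on the left and by the [p] on the right, to
     avoid negative integers. *)
  have -> : h (phi (c, j)) =
      cos (x0 + 2 * pi * A%:R / t%:R + 2 * pi * (j.1%:R * e1 + j.2%:R * e2) / t%:R).
    rewrite -[LHS](cosD2pin _ (j.1 * q1 + j.2 * q2)).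
    rewrite -[RHS](cosD2pin _ (j.1 * p1 + j.2 * p2)).
    rewrite /h /phase phi1 phi2 /= (split_ix c.1 j.1) (split_ix c.2 j.2) -/b1 -/b2 -/t /e1 /e2 /A; congr cos.
    by rewrite -[(rs_len1 P).+1]/t !natrD !natrM !natrD !natrM; field; rewrite gt_eqF.
  apply: le_trans (cos_lipschitz _ _) _; rewrite addrAC subrr add0r.
  have bnd (i : 'I_m) e : `|e| * (m ^ 2)%:R <= t%:R -> `|i%:R * e / t%:R| <= 1 / m%:R :> R.
    move=> he; rewrite !normrM normfV !normr_nat ler_pdivrMr // mulrAC ler_pdivlMr // mul1r.
    apply: le_trans he; rewrite mulrAC [leRHS]mulrC ler_wpM2r //.
    by rewrite natrX expr2 ler_wpM2r // ler_nat ltnW.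
  have := bnd j.1 _ h1; have := bnd j.2 _ h2; rewrite -/e1 -/e2.
  have -> : 2 * pi * (j.1%:R * e1 + j.2%:R * e2) / t%:R =
     2 * pi * (j.1%:R * e1 / t%:R + j.2%:R * e2 / t%:R) :> R by ring.
  set y1 := j.1%:R * e1 / t%:R; set y2 := j.2%:R * e2 / t%:R => hy2 hy1.
  have pi4 : pi <= 4 :> R by have := pihalf_lt2 R; lra.
  have pip := @pi_gt0 R.
  rewrite normrM ger0_norm ?mulr_ge0 ?(ltW pip) //.
  have hy : `|y1 + y2| <= 2 / m%:R by apply: le_trans (ler_normD _ _) _; lra.
  apply: (@le_trans _ _ (2 * 4 * (2 / m%:R))); last by lra.
  by apply: ler_pM => //; [rewrite mulr_ge0 ?(ltW pip)|lra].
have sumf : \sum_s f s = #|` W `&` rs_set P|%:R by rewrite card_fsetI_rs_set_sum.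
have big' : 2 * gamma * (t%:R ^+ 2) ^+ 2 <=
   (\sum_s (f s - (\sum_s f s) / t%:R ^+ 2) * h s) ^+ 2.
  rewrite -exprM; apply: le_trans big _; rewrite le_eqVlt; apply/orP; left; apply/eqP.
  congr (_ ^+ 2); apply: eq_bigr => s _; congr (_ * _).
  by rewrite /balanced in_rs_image sumf card_fsetI_rs_set.
have := @energy_increment R _ _ _ phi f h hc (16 / m%:R) gamma phi_inj _ _ f01 h1'
  (fun c => h1' _) hhc.
rewrite /= cardC Nt Mm => /(_ _ _ big') H.
rewrite big_map big_enum /=.
have -> : \sum_c energy R W (C c) = \sum_c (\sum_j f (phi (c, j))) ^+ 2 / m%:R ^+ 2.
  apply: eq_bigr => c _; rewrite /energy card_fsetI_rs_set_sum card_rs_set natrX.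
  by congr (_ ^+ 2 / _); apply: eq_bigr => j _; rewrite CE.
apply: le_trans (H _ _); [|by rewrite card_prod card_ord|by rewrite divr_ge0].
rewrite /energy card_rs_set -/t natrX sumf.
have m1le : 1 <= m%:R :> R by rewrite ler1n.
have hm3 : t%:R ^+ 2 / m%:R ^+ 3 <= t%:R ^+ 2 / m%:R :> R.
  rewrite ler_wpM2l ?exprn_ge0 // lef_pV2 ?posrE ?exprn_gt0 //.
  by rewrite exprS ler_peMr ?exprn_ege1 // ltW.
(* The constant is [40 = 2 * 16 + 4 * 2]: variation of the character on tiles, then uncovered
   points. *)
move: cov hm3; rewrite -!mulrA; lra.
Qed.

End Tiling.

(** * Families of disjoint squares and double counting *)

Section Multiplicity.
Local Open Scope ring_scope.
Implicit Types (A B W : {fset nat * nat}) (P C : right_square) (s L : seq right_square).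

(** A bound of this count by [(x \in A)] at every [x] says at once that the squares of the list are
    pairwise disjoint and contained in [A]. *)
Definition multiplicity s (x : nat * nat) : nat := (\sum_(P <- s) (x \in rs_set P))%N.

Lemma card_fsetI_sum A B : #|` A `&` B| = (\sum_(x <- A) (x \in B))%N.
Proof.
rewrite card_fset_sum1 -(@big_fset_incl _ _ _ _ (A `&` B) A).
- rewrite big_seq_cond [RHS]big_seq_cond; apply: eq_bigr => x.
  by rewrite andbT in_fsetI => /andP[_ ->].
- exact: fsubsetIl.
- by move=> x xA; rewrite in_fsetI xA /= => /negbTE ->.
Qed.

Lemma sum_card_fsetI A s :
  (\sum_(P <- s) #|` A `&` rs_set P| = \sum_(x <- A) multiplicity s x)%N.
Proof.
rewrite /multiplicity exchange_big /=.
by apply: eq_bigr => P _; exact: card_fsetI_sum.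
Qed.

Lemma multiplicity_sub A s : (forall x, multiplicity s x <= (x \in A))%N ->
  all (fun P => rs_set P `<=` A) s.
Proof.
elim: s => //= P s IHs hs; apply/andP; split; last first.
  by apply: IHs => x; apply: leq_trans (hs x); rewrite /multiplicity big_cons leq_addl.
apply/fsubsetP => x xP; have := hs x.
by rewrite /multiplicity big_cons xP; case: (x \in A).
Qed.

Lemma sum_card_rs_setE A s : (forall x, multiplicity s x <= (x \in A))%N ->
  (\sum_(P <- s) #|` rs_set P| = \sum_(P <- s) #|` A `&` rs_set P|)%N.
Proof.
elim: s => [|P s IHs] hs; first by rewrite !big_nil.
have /andP[/fsetIidPr eP _] := multiplicity_sub hs.
rewrite !big_cons eP; congr (_ + _)%N; apply: IHs => x.
by apply: leq_trans (hs x); rewrite /multiplicity big_cons leq_addl.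
Qed.

Lemma sum_card_fsetI_le A s : (forall x, multiplicity s x <= 1)%N ->
  (\sum_(P <- s) #|` A `&` rs_set P| <= #|` A|)%N.
Proof.
by move=> hs; rewrite sum_card_fsetI card_fset_sum1; apply: leq_sum => x _; exact: hs.
Qed.

Lemma sum_card_rs_set_le A s : (forall x, multiplicity s x <= (x \in A))%N ->
  (\sum_(P <- s) #|` rs_set P| <= #|` A|)%N.
Proof.
move=> hs; rewrite (sum_card_rs_setE hs); apply: sum_card_fsetI_le => x.
exact: leq_trans (hs x) (leq_b1 _).
Qed.

Lemma grid_square N1 : rs_set (@RightSquare 1 1 1 N1 isT) = grid N1.+1.
Proof.
rewrite /rs_set /grid; cbn [rs_a rs_b rs_d rs_len rs_len1].
suff -> : arith_prog 1 1 N1.+1 = [fset i | i in iota 1 N1.+1] by [].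
apply/fsetP => x; apply/arith_progP/imfsetP => /= -[k kN ->].
  exists (1 + k * 1)%N => //.
  have : (1 + k * 1)%N \in iota 1 N1.+1 by rewrite mem_iota; lia.
  by [].
have : k \in iota 1 N1.+1 by [].
by rewrite mem_iota => hk; exists k.-1; lia.
Qed.

Lemma card_grid N1 : #|` grid N1.+1| = (N1.+1 ^ 2)%N.
Proof. by rewrite -grid_square card_rs_set. Qed.

End Multiplicity.

(** * Refining a whole family of squares *)

Section Refinement.
Local Open Scope ring_scope.
Variables (R : realType) (W : {fset nat * nat}).
Implicit Types (P C : right_square) (s L : seq right_square).

Lemma energy_le P : energy R W P <= #|` rs_set P|%:R.
Proof.
have P0 : 0 < #|` rs_set P|%:R :> R by rewrite ltr0n card_rs_set expn_gt0.
rewrite /energy ler_pdivrMr // -expr2 ler_sqr ?nnegrE // ler_nat.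
by rewrite fsubset_leq_card // fsubsetIr.
Qed.

Lemma energy_ge0 P : 0 <= energy R W P.
Proof. by rewrite /energy divr_ge0 ?sqr_ge0. Qed.

(** Multiplicities, areas and energies all add under concatenation. [gain] depends on the square,
    since only bad squares will contribute. *)
Lemma refine_all (keep new : pred right_square) (tau : R) (gain : right_square -> R) s :
  (forall P, keep P -> exists L,
    [/\ forall x, (multiplicity L x <= (x \in rs_set P))%N, all new L,
        (1 - tau) * #|` rs_set P|%:R <= \sum_(C <- L) #|` rs_set C|%:R :> R &
        energy R W P + gain P <= \sum_(C <- L) energy R W C]) ->
  all keep s ->
  exists L,
    [/\ forall x, (multiplicity L x <= multiplicity s x)%N, all new L,
        (1 - tau) * \sum_(P <- s) #|` rs_set P|%:R <=
          \sum_(C <- L) #|` rs_set C|%:R :> R &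
        \sum_(P <- s) (energy R W P + gain P) <= \sum_(C <- L) energy R W C].
Proof.
move=> refine; elim: s => [_|P s IHs /= /andP[/refine[L [m1 n1 c1 e1]] /IHs[L' [m2 n2 c2 e2]]]].
  by exists [::]; split; rewrite ?big_nil ?mulr0 // => x; rewrite /multiplicity !big_nil.
exists (L ++ L'); split.
- by move=> x; rewrite /multiplicity big_cat big_cons leq_add ?m1 ?m2.
- by rewrite all_cat n1.
- by rewrite big_cat big_cons mulrDr lerD.
- by rewrite big_cat big_cons lerD.
Qed.

End Refinement.

(** * The energy increment iteration *)

Definition threshold (R : realType) (K rho x : R) : R := (K * x `^ rho)%R.

Lemma succn_le_sqr (n : nat) : (2 <= n)%N -> (n.+1 <= n ^ 2)%N.
Proof. by rewrite -mulnn; nia. Qed.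

Section Iteration.
Local Open Scope ring_scope.
Variables (R : realType) (epsilon K rho : R) (N1 : nat) (W : {fset nat * nat}).
Local Notation N := N1.+1.
Local Notation alphaf := (threshold K rho).
Local Notation alpha := (alphaf epsilon).
Hypotheses (eps_gt0 : 0 < epsilon) (eps_le1 : epsilon <= 1).
Hypotheses (K_gt0 : 0 < K) (K_le1 : K <= 1) (rho_ge1 : 1 <= rho).
Hypothesis alpha_le : alpha <= 2 ^- 12.
Implicit Types (P C : right_square) (s L : seq right_square).

Definition regular_square P : bool :=
  `[< uniform_in (alphaf (density R W (rs_set P))) W P >].

Definition dense_square P : bool :=
  epsilon * #|` rs_set P|%:R <= #|` W `&` rs_set P|%:R.

Definition bad_square P : bool := dense_square P && ~~ regular_square P.

Lemma alpha_gt0 : 0 < alpha.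
Proof. by rewrite mulr_gt0 // powR_gt0. Qed.

Lemma alpha_le_eps : alpha <= epsilon.
Proof.
apply: (@le_trans _ _ (epsilon `^ rho)); first by rewrite ler_piMl ?powR_ge0.
by apply: ge1r_powR => //; rewrite eps_gt0.
Qed.

(** The second bound is [eta ^ rho >= eta epsilon ^ (rho - 1)]; it makes the gain on a square
    proportional to its number of points of [W], which can be summed over all bad squares. *)
Lemma alphaf_ge (eta : R) : epsilon <= eta ->
  alpha <= alphaf eta /\ alpha / epsilon * eta <= alphaf eta.
Proof.
move=> he; have eta0 : 0 < eta by apply: lt_le_trans he.
have rho0 : 0 < rho by apply: lt_le_trans rho_ge1.
split.
  by rewrite ler_pM2l // ge0_ler_powR ?nnegrE // ltW.
rewrite /threshold -!mulrA ler_pM2l //.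
rewrite -(@mulr_powRB1 _ epsilon) ?(ltW eps_gt0) // -(@mulr_powRB1 _ eta) ?(ltW eta0) //.
rewrite [leLHS](_ : _ = eta * epsilon `^ (rho - 1)); last by field; rewrite gt_eqF.
by rewrite ler_pM2l // ge0_ler_powR ?nnegrE ?subr_ge0 // ltW.
Qed.

(** Squares that are not bad are kept. A bad one is split with [m] the integer part of the eighth
    root of its side; then its side is at most [(m + 1) ^ 8 <= m ^ 16], which is why the exponent
    grows by a factor 16 per round. *)
Lemma refine_square (k : nat) P :
  (forall m, (N <= m ^ (16 ^ k.+1))%N -> 1 <= alpha ^+ 2 * m%:R) ->
  (N <= rs_len P ^ (16 ^ k))%N ->
  exists L,
    [/\ forall x, (multiplicity L x <= (x \in rs_set P))%N,
        all (fun C => N <= rs_len C ^ (16 ^ k.+1))%N L,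
        (1 - alpha ^+ 2 / 2) * #|` rs_set P|%:R <= \sum_(C <- L) #|` rs_set C|%:R :> R &
        energy R W P +
          (if bad_square P then alpha / epsilon * #|` W `&` rs_set P|%:R else 0) <=
          \sum_(C <- L) energy R W C].
Proof.
move=> hm hP; have a0 := alpha_gt0.
have powle (m n : nat) : (m <= n)%N -> (m ^ (16 ^ k) <= n ^ (16 ^ k))%N.
  by move=> mn; rewrite leq_exp2r // expn_gt0.
case: ifP => [/andP[dP /asboolP nu]|_]; last first.
  exists [:: P]; split.
  - by move=> x; rewrite /multiplicity big_seq1.
  - rewrite /= andbT; apply: leq_trans hP _.
    by rewrite leq_pexp2l // leq_exp2l.
  - by rewrite big_seq1 ler_piMl // gerBl divr_ge0 // sqr_ge0.
  - by rewrite big_seq1 addr0.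
have ex0 : exists m, (m ^ 8 <= rs_len P)%N by exists 0%N.
have bnd m : (m ^ 8 <= rs_len P)%N -> (m <= rs_len P)%N.
  apply: leq_trans; case: m => // m; rewrite -{1}[m.+1]expn1.
  by rewrite leq_pexp2l.
have [m mt mmax] := ex_maxnP ex0 bnd.
have tm : (rs_len P <= m.+1 ^ 8)%N.
  by rewrite ltnW // ltnNge; apply/negP => /mmax; rewrite ltnn.
(* The hypothesis is first applied to [m + 1]: this yields [2 <= m], without which [m + 1 <= m ^ 2]
   fails and nothing could be said about [m]. *)
have m1big : 1 <= alpha ^+ 2 * m.+1%:R.
  apply: hm; apply: leq_trans hP _; apply: leq_trans (powle _ _ tm) _.
  by rewrite -expnM leq_pexp2l // expnS leq_mul2r orbT.
have a2 : alpha ^+ 2 <= 2 ^- 12 * alpha by rewrite expr2 ler_wpM2r // ltW.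
have a212 : 2 ^- 12 = 4096^-1 :> R by rewrite -natrX.
have m2 : (2 <= m)%N.
  rewrite -ltnS -(ltr_nat R).
  have m0 : 0 < m.+1%:R :> R by rewrite ltr0n.
  move: alpha_le a2; rewrite a212 => al a2.
  have : alpha ^+ 2 <= 8^-1 by nra.
  by move: m1big; nra.
have tm16 : (rs_len P <= m ^ 16)%N.
  apply: leq_trans tm _; have -> : (m ^ 16 = (m ^ 2) ^ 8)%N by rewrite -expnM.
  by rewrite leq_exp2r // succn_le_sqr.
have newm : (N <= m ^ (16 ^ k.+1))%N.
  by apply: leq_trans hP _; apply: leq_trans (powle _ _ tm16) _; rewrite -expnM -expnS.
have mbig := hm m newm.
have mp : 0 < m%:R :> R by rewrite ltr0n; apply: leq_trans m2.
set eta := density R W (rs_set P).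
have P0 : 0 < #|` rs_set P|%:R :> R by rewrite ltr0n card_rs_set expn_gt0.
have heta : epsilon <= eta by rewrite /eta /density ler_pdivlMr.
have [ag aeg] := alphaf_ge heta.
have [||L [L1 L2 L3 L4]] := split_square _ mt _ nu.
- by apply: leq_trans m2.
- by apply: le_trans ag; rewrite ltW.
exists L; split => //.
- by apply: sub_all L2 => C /eqP ->.
- apply: le_trans L3; rewrite ler_wpM2r // lerD2l lerN2.
  have im : m%:R^-1 <= alpha ^+ 2 by rewrite -[leLHS]mul1r ler_pdivrMr.
  rewrite -exprVn; set y := m%:R^-1 in im *.
  have y0 : 0 <= y by rewrite invr_ge0 ltW.
  move: alpha_le a2; rewrite a212 => al a2.
  have y1 : y <= 2^-1 by nra.
  have : y ^+ 3 <= alpha ^+ 2 / 4.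
    rewrite exprS; apply: ler_pM => //; first exact: sqr_ge0.
    by rewrite expr2; nra.
  by lra.
- apply: le_trans L4; rewrite lerD2l.
  have -> : #|` W `&` rs_set P|%:R = eta * #|` rs_set P|%:R :> R.
    by rewrite /eta /density divfK // gt_eqF.
  rewrite mulrA ler_wpM2r //; apply: le_trans aeg _.
  (* Of the gain [2 alphaf eta], one half absorbs this error and the other is at least
     [alpha / epsilon * eta]. *)
  have im : 40 / m%:R <= alpha.
    rewrite ler_pdivrMr //; move: alpha_le; rewrite a212 => al.
    by move: mbig; rewrite expr2; nra.
  by move: ag; rewrite -/eta; lra.
Qed.

(* While the bad squares carry mass [2 epsilon N ^ 2], a refinement raises the
   energy by [2 alpha N ^ 2]; the energy never exceeds [N ^ 2]. *)
Lemma regular_partition (k0 : nat) :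
  (forall m, (N <= m ^ (16 ^ k0))%N -> 1 <= alpha ^+ 2 * m%:R) ->
  1 < alpha * k0%:R ->
  exists s,
    [/\ forall x, (multiplicity s x <= (x \in grid N))%N,
        all (fun C => N <= rs_len C ^ (16 ^ k0))%N s,
        (1 - k0%:R * (alpha ^+ 2 / 2)) * N%:R ^+ 2 <= \sum_(C <- s) #|` rs_set C|%:R :> R &
        \sum_(C <- s | bad_square C) #|` W `&` rs_set C|%:R < 2 * epsilon * N%:R ^+ 2 :> R].
Proof.
move=> hm hk0; apply: contrapT => /forallNP none.
have a0 := alpha_gt0.
have N0 : 0 < N%:R :> R by rewrite ltr0n.
set tau := alpha ^+ 2 / 2 in none.
have tau0 : 0 <= tau by rewrite divr_ge0 ?sqr_ge0.
have expM k m : (k <= k0)%N -> (N <= m ^ (16 ^ k))%N -> (N <= m ^ (16 ^ k0))%N.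
  move=> kk0; case: m => [|m]; first by rewrite exp0n // expn_gt0.
  by move=> h; apply: leq_trans h _; rewrite leq_pexp2l // leq_exp2l.
(* If no family qualifies, the bad squares are heavy at every stage up to [k0], so each refinement
   gains energy. *)
have step k : (k <= k0)%N -> exists s,
    [/\ forall x, (multiplicity s x <= (x \in grid N))%N,
        all (fun C => N <= rs_len C ^ (16 ^ k))%N s,
        (1 - k%:R * tau) * N%:R ^+ 2 <= \sum_(C <- s) #|` rs_set C|%:R :> R &
        2 * k%:R * alpha * N%:R ^+ 2 <= \sum_(C <- s) energy R W C].
  elim: k => [_|k IHk kk0].
    exists [:: @RightSquare 1 1 1 N1 isT]; split.
    - by move=> x; rewrite /multiplicity big_seq1 grid_square.
    - by rewrite /= /rs_len /= expn0 expn1 leqnn.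
    - by rewrite big_seq1 grid_square card_grid natrX mul0r subr0 mul1r.
    - by rewrite big_seq1 mulr0 !mul0r energy_ge0.
  have [s [s1 s2 s3 s4]] := IHk (ltnW kk0).
  have [|L [L1 L2 L3 L4]] := @refine_all R W _ (fun C => N <= rs_len C ^ (16 ^ k.+1))%N
     tau (fun P => if bad_square P then alpha / epsilon * #|` W `&` rs_set P|%:R else 0) s _ s2.
    by move=> P hP; apply: refine_square => // m /(expM _ _ kk0); exact: hm.
  have notgood : 2 * epsilon * N%:R ^+ 2 <=
      \sum_(C <- s | bad_square C) #|` W `&` rs_set C|%:R :> R.
    rewrite leNgt; apply/negP => good; apply: (none s); split=> //.
    - by apply: sub_all s2 => C; apply: expM; exact: ltnW.
    - apply: le_trans s3; rewrite ler_wpM2r ?exprn_ge0 // lerD2l lerN2 ler_wpM2r //.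
      by rewrite ler_nat ltnW.
  exists L; split => //.
  - by move=> x; apply: leq_trans (L1 x) (s1 x).
  - apply: le_trans L3.
    (* Successive losses: [(1 - tau) (1 - k tau)] exceeds [1 - (k + 1) tau] by [k tau ^ 2]. *)
    have := mulr_ge0 (mulr_ge0 (ler0n R k) (sqr_ge0 tau)) (ltW (exprn_gt0 2 N0)).
    have [tau1|tau1] := lerP tau 1.
      have : (1 - tau) * ((1 - k%:R * tau) * N%:R ^+ 2) <=
        (1 - tau) * \sum_(P <- s) #|` rs_set P|%:R by rewrite ler_wpM2l // subr_ge0.
      by rewrite -natr1; lra.
    have : tau < 1.
      rewrite /tau; have := alpha_le; rewrite -natrX => al.
      have : alpha ^+ 2 <= 1 by rewrite exprn_ile1 // ?ltW //; lra.
      lra.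
    by lra.
  - apply: le_trans L4; rewrite big_split /= -big_mkcond /= -mulr_sumr.
    have : alpha / epsilon * (2 * epsilon * N%:R ^+ 2) <=
      alpha / epsilon * \sum_(P <- s | bad_square P) #|` W `&` rs_set P|%:R.
      by rewrite ler_wpM2l // divr_ge0 // ltW.
    have -> : alpha / epsilon * (2 * epsilon * N%:R ^+ 2) = 2 * alpha * N%:R ^+ 2.
      by field; rewrite gt_eqF.
    by rewrite -natr1; lra.
have [s [s1 _ _ s4]] := step k0 (leqnn _).
have : \sum_(C <- s) energy R W C <= N%:R ^+ 2.
  apply: (@le_trans _ _ (\sum_(C <- s) #|` rs_set C|%:R)).
    by apply: ler_sum => C _; exact: energy_le.
  by rewrite -natr_sum -natrX -card_grid ler_nat; exact: sum_card_rs_set_le.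
have : N%:R ^+ 2 < (alpha * k0%:R) * N%:R ^+ 2 by rewrite ltr_pMl ?exprn_gt0.
by have := exprn_gt0 2 N0; lra.
Qed.

End Iteration.

(** * From the final family to the required decomposition *)

Section Conclusion.
Local Open Scope ring_scope.
Variables (R : realType) (epsilon K rho : R) (N1 : nat) (W : {fset nat * nat}).
Local Notation N := N1.+1.

(** The dense regular squares are kept and [B] is the rest of [W]: at most [epsilon N ^ 2] points
    outside all squares, at most [epsilon N ^ 2] in sparse squares, and fewer than [2 epsilon N ^ 2]
    in bad ones. *)
Lemma squares_of_partition (e : nat) (s : seq right_square) :
  0 < epsilon -> W `<=` grid N ->
  (forall x, (multiplicity s x <= (x \in grid N))%N) ->
  all (fun C => N <= rs_len C ^ e)%N s ->
  (1 - epsilon) * N%:R ^+ 2 <= \sum_(C <- s) #|` rs_set C|%:R :> R ->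
  \sum_(C <- s | bad_square epsilon K rho W C) #|` W `&` rs_set C|%:R
    < 2 * epsilon * N%:R ^+ 2 :> R ->
  exists (M : nat) (P : 'I_M -> right_square) (B : {fset nat * nat}),
    [/\ forall i, rs_set (P i) `<=` grid N,
        [/\ W = (\bigcup_(i in 'I_M) (W `&` rs_set (P i))) `|` B,
            forall i j, i != j ->
              fdisjoint (W `&` rs_set (P i)) (W `&` rs_set (P j)) &
            forall i, fdisjoint (W `&` rs_set (P i)) B],
        forall i, uniform_in (threshold K rho (density R W (rs_set (P i)))) W (P i),
        forall i, epsilon * #|` rs_set (P i)|%:R <= #|` W `&` rs_set (P i)|%:R /\
          (N <= rs_len (P i) ^ e)%N
      & #|` B|%:R < 4 * epsilon * N%:R ^+ 2].
Proof.
move=> e0 WN ms lens cov bad.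
pose good P := dense_square epsilon W P && regular_square K rho W P.
pose sg := [seq P <- s | good P].
have msg x : (multiplicity sg x <= multiplicity s x)%N.
  by rewrite /multiplicity big_filter [leqRHS](bigID good) /= leq_addr.
have msgN x : (multiplicity sg x <= (x \in grid N))%N := leq_trans (msg x) (ms x).
pose P (i : 'I_(size sg)) := tnth (in_tuple sg) i.
have multE x : multiplicity sg x = (\sum_(i < size sg) (x \in rs_set (P i)))%N.
  by rewrite /multiplicity big_tnth.
have allP_ (p : pred right_square) (i : 'I_(size sg)) : all p sg -> p (P i).
  by move=> ap; rewrite /P (tnth_nth (P i)); apply: all_nthP ap _ _; exact: ltn_ord.
have goodP i : good (P i) by apply: allP_; exact: filter_all.
set U := \bigcup_(i in 'I_(size sg)) (W `&` rs_set (P i)).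
have inU x : x \in U -> (x \in W) /\ exists i, x \in rs_set (P i).
  by case/bigfcupP => i _; rewrite in_fsetI => /andP[xW xP]; split => //; exists i.
have Uin x i : x \in W -> x \in rs_set (P i) -> x \in U.
  move=> xW xP; apply/bigfcupP; exists i; last by rewrite in_fsetI xW.
  by rewrite mem_index_enum.
exists (size sg), P, (W `\` U); split.
- by move=> i; apply: (allP_ (fun Q => rs_set Q `<=` grid N)); exact: multiplicity_sub.
- split.
  + apply/fsetP => x; rewrite in_fsetU in_fsetD.
    by case xU: (x \in U) => //=; have [] := inU x xU.
  + move=> i j ij; apply/fdisjointP => x; rewrite !in_fsetI => /andP[xW xi].
    apply/negP => /andP[_ xj]; have := leq_trans (msgN x) (leq_b1 _).
    by rewrite multE (bigD1 i) //= (bigD1 j) 1?eq_sym //= xi xj.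
  + move=> i; apply/fdisjointP => x; rewrite in_fsetI => /andP[xW xi].
    by rewrite in_fsetD (Uin x i).
- by move=> i; have /andP[_ /asboolP] := goodP i.
- move=> i; split; first by have /andP[] := goodP i.
  apply: (allP_ (fun Q => N <= rs_len Q ^ e)%N).
  by rewrite all_filter; apply: sub_all lens => Q lQ; apply/implyP.
have cardB : (#|` W `\` U| + \sum_(Q <- sg) #|` W `&` rs_set Q| <= #|` W|)%N.
  have -> : #|` W `\` U| = (\sum_(x <- W) (x \in W `\` U))%N.
    by rewrite -card_fsetI_sum (fsetIidPr _) // fsubsetDl.
  rewrite sum_card_fsetI -big_split card_fset_sum1 /=.
  rewrite big_seq_cond [leqRHS]big_seq_cond; apply: leq_sum => x /andP[xW _].
  rewrite in_fsetD xW andbT; case: (boolP (x \in U)) => xU /=.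
    exact: leq_trans (msgN x) (leq_b1 _).
  rewrite multE big1 // => i _; case xi: (x \in rs_set (P i)) => //.
  by rewrite (Uin x i) in xU.
(* [W] misses the family in at most as many points as the grid does; the additive form avoids
   truncated subtraction. *)
have uncov : (#|` W| + \sum_(Q <- s) #|` rs_set Q| <=
    N ^ 2 + \sum_(Q <- s) #|` W `&` rs_set Q|)%N.
  rewrite (sum_card_rs_setE ms) -card_grid -(cardfsID W (grid N)) (fsetIidPr WN).
  rewrite -addnA leq_add2l.
  apply: (@leq_trans (\sum_(Q <- s) (#|` W `&` rs_set Q| +
                                     #|` (grid N `\` W) `&` rs_set Q|))%N).
    apply: leq_sum => Q _; rewrite -(cardfsID W (grid N `&` rs_set Q)).
    by rewrite fsetIAC (fsetIidPr WN) fsetIDAC.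
  rewrite big_split /= addnC leq_add2r; apply: sum_card_fsetI_le => x.
  exact: leq_trans (ms x) (leq_b1 _).
have sparse : \sum_(Q <- s | ~~ dense_square epsilon W Q) #|` W `&` rs_set Q|%:R
    <= epsilon * N%:R ^+ 2.
  apply: (@le_trans _ _ (epsilon * \sum_(Q <- s | ~~ dense_square epsilon W Q) #|` rs_set Q|%:R)).
    rewrite mulr_sumr; apply: ler_sum => Q; rewrite -ltNge; exact: ltW.
  rewrite ler_pM2l //; apply: (@le_trans _ _ (\sum_(Q <- s) #|` rs_set Q|%:R)).
    by rewrite [leRHS](bigID (dense_square epsilon W)) /= lerDr sumr_ge0.
  rewrite -natr_sum -natrX -card_grid ler_nat; exact: sum_card_rs_set_le.
have split3 : \sum_(Q <- s) #|` W `&` rs_set Q|%:R =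
   \sum_(Q <- sg) #|` W `&` rs_set Q|%:R +
   \sum_(C <- s | bad_square epsilon K rho W C) #|` W `&` rs_set C|%:R +
   \sum_(Q <- s | ~~ dense_square epsilon W Q) #|` W `&` rs_set Q|%:R :> R.
  rewrite (bigID (dense_square epsilon W)) /=; congr (_ + _).
  by rewrite (bigID (regular_square K rho W)) /= big_filter.
move: cardB uncov; rewrite -!(ler_nat R) !natrD !natr_sum natrX.
have N0 : 0 < N%:R :> R by rewrite ltr0n.
by have := exprn_gt0 2 N0; lra.
Qed.

End Conclusion.

(** * Numerical consequences of the lower bound on [N] *)

Section Thresholds.
Local Open Scope ring_scope.
Variables (R : realType) (rho alpha : R) (N : nat).
Local Notation L := ((1 / 2 ^- 128) `^ (1 / alpha) : R).
Hypotheses (rho_ge4 : 4 <= rho) (alpha_gt0 : 0 < alpha) (alpha_le : alpha <= 2 ^- 12).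
Hypothesis N_large : ((2 `^ (1000 * rho)) * alpha `^ (100 * rho)) `^ (- L) <= N%:R.

Local Notation k0 := (Num.truncn (1 / alpha)).+1.

Lemma exponent_ge1 : 1 <= L.
Proof.
rewrite -[leLHS](powRr0 (1 / 2 ^- 128)) ler_powR //.
  by rewrite div1r invrK exprn_ege1 // ler1n.
by rewrite divr_ge0 // ltW.
Qed.

(** [L = 2 ^ (128 / alpha)], while [4 k0 <= 4 / alpha + 4 <= 128 / alpha]. *)
Lemma exponent_steps : (16 ^ k0)%:R <= L.
Proof.
have -> : (16 ^ k0)%:R = 2 `^ (4 * k0%:R) :> R.
  rewrite powRrM (powR_mulrn 4) // powR_mulrn ?exprn_ge0 // natrX.
  by congr (_ ^+ _); rewrite -natrX.
have -> : 1 / 2 ^- 128 = 2 `^ 128 :> R by rewrite div1r invrK (powR_mulrn 128).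
rewrite -powRrM.
apply: ler_powR; first by rewrite ler1n.
have /andP[tl _] := truncn_itv (divr_ge0 ler01 (ltW alpha_gt0)).
have : 1 <= 1 / alpha by rewrite ler_pdivlMr // mul1r; move: alpha_le; rewrite -natrX; lra.
by rewrite -natr1; lra.
Qed.

Lemma steps_gt : 1 < alpha * k0%:R.
Proof.
have /andP[_ tl] := truncn_itv (divr_ge0 ler01 (ltW alpha_gt0)).
by move: tl; rewrite ltr_pdivrMr // mulrC.
Qed.

(** Bounds the proportion of area lost over all rounds, using [k0 alpha <= 1 + alpha <= 2]. *)
Lemma steps_le : k0%:R * (alpha ^+ 2 / 2) <= alpha.
Proof.
have /andP[tl _] := truncn_itv (divr_ge0 ler01 (ltW alpha_gt0)).
have : k0%:R * alpha <= 1 + alpha.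
  by move: tl; rewrite ler_pdivlMr // -natr1 mulrDl mul1r; lra.
have : alpha <= 1 by move: alpha_le; rewrite -natrX; lra.
rewrite expr2; move: alpha_gt0; nra.
Qed.

(** The left side is [b ^ (100 rho)] with [b = 2 ^ 10 alpha <= 1], hence at most [b ^ 12]; and
    [b ^ 6 <= alpha] because [2 ^ 60 alpha ^ 5 <= 1]. *)
Lemma base_le : (2 `^ (1000 * rho)) * alpha `^ (100 * rho) <= alpha ^+ 2.
Proof.
have -> : 1000 * rho = 10 * (100 * rho) by ring.
rewrite powRrM -powRM ?powR_ge0 ?(ltW alpha_gt0) //.
rewrite (powR_mulrn 10) //.
set b := 2 ^+ 10 * alpha.
have p2 n : 0 < 2 ^+ n :> R by rewrite exprn_gt0 // ltr0n.
have b0 : 0 < b by rewrite mulr_gt0.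
have b1 : b <= 1.
  apply: (@le_trans _ _ (2 ^+ 10 * 2 ^- 12)); first by rewrite ler_pM2l.
  by rewrite ler_pdivrMr // mul1r ler_eXn2l // ltr1n.
have b6 : b ^+ 6 <= alpha.
  have -> : b ^+ 6 = ((2 ^+ 10) ^+ 6 * alpha ^+ 5) * alpha by rewrite /b; ring.
  rewrite ler_piMl ?(ltW alpha_gt0) //.
  apply: (@le_trans _ _ ((2 ^+ 10) ^+ 6 * (2 ^- 12) ^+ 5)).
    by rewrite ler_pM2l ?exprn_gt0 // lerXn2r ?nnegrE ?invr_ge0 ?(ltW (p2 _)) ?(ltW alpha_gt0).
  by rewrite exprVn -!exprM ler_pdivrMr // mul1r.
apply: (@le_trans _ _ (b `^ 12)).
  apply: ger_powR; first by rewrite b0.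
  by have := rho_ge4; lra.
rewrite (powR_mulrn 12) ?(ltW b0) //.
have -> : b ^+ 12 = (b ^+ 6) ^+ 2 by rewrite -exprM.
by rewrite lerXn2r ?nnegrE ?exprn_ge0 ?(ltW b0) ?(ltW alpha_gt0).
Qed.

(** With [X] the base in [N_large], [X ^ (- L) <= N <= m ^ L] forces
    [m >= 1 / X >= 1 / alpha ^ 2]. *)
Lemma side_large (m : nat) : (N <= m ^ (16 ^ k0))%N -> 1 <= alpha ^+ 2 * m%:R.
Proof.
move=> hm; have L1 := exponent_ge1; have Ls := exponent_steps.
have base0 : 0 < (2 `^ (1000 * rho)) * alpha `^ (100 * rho) :> R.
  by rewrite mulr_gt0 ?powR_gt0.
move: N_large base_le base0; set X := _ * _ => NX Xa X0.
have N0 : 0 < N%:R :> R by apply: lt_le_trans NX; exact: powR_gt0.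
have m0 : (0 < m)%N.
  by move: hm N0; rewrite ltr0n; case: m => //; rewrite exp0n ?expn_gt0 //; lia.
have mL : N%:R <= m%:R `^ L.
  apply: (@le_trans _ _ (m%:R `^ (16 ^ k0)%:R)).
    by rewrite powR_mulrn // -natrX ler_nat.
  by apply: ler_powR => //; rewrite ler1n.
have : X^-1 `^ L <= m%:R `^ L.
  by apply: le_trans mL; rewrite -powR_inv1 ?(ltW X0) // -powRrM mulN1r.
have Xm : X^-1 <= m%:R -> 1 <= alpha ^+ 2 * m%:R.
  move=> h; apply: (@le_trans _ _ (X * m%:R)); last by rewrite ler_wpM2r.
  by move: h; rewrite -[X^-1]mul1r ler_pdivrMr // mulrC.
move=> h; apply: Xm; rewrite leNgt; apply/negP => lt.
have L0 : 0 < L by apply: lt_le_trans L1.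
by have := gt0_ltr_powR L0 _ _ lt; rewrite ?nnegrE // invr_ge0 (ltW X0) => /(_ (ler0n _ _) isT); rewrite ltNge h.
Qed.

(** The exponent on the left is [1 / L], and [N <= t ^ L]. *)
Lemma size_large (t : nat) : (0 < t)%N -> (N <= t ^ (16 ^ k0))%N ->
  N%:R `^ ((2 ^- 128) `^ (1 / alpha)) <= (t ^ 2)%:R :> R.
Proof.
move=> t0 ht; have L1 := exponent_ge1; have Ls := exponent_steps.
have L0 : 0 < L by apply: lt_le_trans L1.
have -> : (2 ^- 128) `^ (1 / alpha) = L^-1.
  rewrite -powRN; move: (1 / alpha) => y; rewrite div1r -[X in _ = X `^ _]powR_inv1.
    by rewrite -powRrM mulN1r opprK.
  by rewrite invr_ge0 exprn_ge0.
have tL : N%:R <= t%:R `^ L.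
  apply: (@le_trans _ _ (t%:R `^ (16 ^ k0)%:R)).
    by rewrite powR_mulrn // -natrX ler_nat.
  by apply: ler_powR => //; rewrite ler1n.
apply: (@le_trans _ _ ((t%:R `^ L) `^ L^-1)).
  by apply: ge0_ler_powR; rewrite ?nnegrE ?powR_ge0 ?invr_ge0 ?(ltW L0).
rewrite -powRrM divff ?gt_eqF // powRr1 // ler_nat.
by rewrite -{1}[t]expn1 leq_pexp2l.
Qed.

End Thresholds.

(** * Assembly: the two degenerate ranges, then the iteration *)

Theorem theorem5p2 (R : realType) (epsilon delta K rho : R)
    (N : nat) (W : {fset nat * nat}) :
  0 < epsilon -> epsilon <= delta ->
  0 < K -> K <= 1 ->
  4 <= rho ->
  let alphaf := fun s : R => K * s `^ rho in
  let C : R := 2 `^ (1000 * rho) in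
  let c1 : R := 100 * rho in
  let c2 : R := 2 ^- 128 in
  let alpha : R := alphaf epsilon in
  W `<=` grid N ->
  #|` W|%:R = delta * N%:R ^+ 2 ->
  (C * alpha `^ c1) `^ (- ((1 / c2) `^ (1 / alpha))) <= N%:R ->
  exists (M : nat) (P : 'I_M -> right_square) (B : {fset nat * nat}),
    [/\ forall i, rs_set (P i) `<=` grid N,
        [/\ W = (\bigcup_(i in 'I_M) (W `&` rs_set (P i))) `|` B,
            forall i j, i != j ->
              fdisjoint (W `&` rs_set (P i)) (W `&` rs_set (P j)) &
            forall i, fdisjoint (W `&` rs_set (P i)) B],
        forall i, uniform_in (alphaf (density R W (rs_set (P i)))) W (P i),
        forall i,
          epsilon * #|` rs_set (P i)|%:R <= #|` W `&` rs_set (P i)|%:R /\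
          N%:R `^ (c2 `^ (1 / alpha)) <= #|` rs_set (P i)|%:R :> R
      & #|` B|%:R < 4 * epsilon * N%:R ^+ 2].
Proof.
move=> eps_gt0 eps_delta K_gt0 K_le1 rho_ge4 alphaf C c1 c2 alpha WN cardW N_large.
have a0 : 0 < alpha by rewrite mulr_gt0 // powR_gt0.
have N0 : (0 < N)%N.
  rewrite -(ltr0n R); apply: lt_le_trans N_large; apply: powR_gt0.
  by rewrite mulr_gt0 // powR_gt0.
case: N N0 => // N1 _ in WN cardW N_large *; set N := N1.+1 in WN cardW N_large *.
(* A sparse [W] is put entirely into [B], with no squares; the square given is a dummy value on
   ['I_0]. *)
have [Wsmall|Wlarge] := ltrP #|` W|%:R (4 * epsilon * N%:R ^+ 2 : R).
  exists 0%N, (fun=> @RightSquare 1 1 1 N1 isT), W.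
  split; [by case| |by case|by case|by []].
  by split; [rewrite big_ord0 fset0U|case|case].
have N2 : 0 < N%:R ^+ 2 :> R by rewrite exprn_gt0 // ltr0n.
have eps_le : epsilon <= 4^-1.
  have : #|` W|%:R <= N%:R ^+ 2 :> R.
    by rewrite -natrX ler_nat -card_grid fsubset_leq_card.
  by move=> /(le_trans Wlarge); rewrite ger_pMl //; lra.
(* For large [alpha] the grid alone works: its density is at least [4 epsilon], so its threshold is
   at least [4 ^ rho * alpha >= 4 ^ 4 / 2 ^ 12 = 1 / 16], where every set is uniform. *)
have [alpha_large|alpha_small] := ltrP (2 ^- 12) alpha.
  pose G := @RightSquare 1 1 1 N1 isT.
  have GE : rs_set G = grid N := grid_square N1.
  have WG : W `&` rs_set G = W by rewrite GE; apply/fsetIidPl.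
  have cG : #|` rs_set G|%:R = N%:R ^+ 2 :> R by rewrite GE card_grid natrX.
  exists 1%N, (fun=> G), fset0; split.
  - by move=> _; rewrite GE.
  - split.
    + by rewrite big_ord_recl big_ord0 WG !fsetU0.
    + by move=> i j; rewrite !ord1 eqxx.
    + by move=> i; rewrite fdisjointX0.
  - move=> _; apply: uniform_large.
    have eta : 4 * epsilon <= density R W (rs_set G).
      by rewrite /density WG cG ler_pdivlMr.
    apply: (@le_trans _ _ (alphaf (4 * epsilon))); last first.
      rewrite ler_pM2l // ge0_ler_powR ?nnegrE //; first by lra.
        by lra.
      by apply: le_trans eta; lra.
    have -> : alphaf (4 * epsilon) = 4 `^ rho * alpha.
      by rewrite /alpha /alphaf powRM ?(ltW eps_gt0) //; ring.
    apply: (@le_trans _ _ (4 ^+ 4 * 2 ^- 12)).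
      by rewrite -!natrX ler_pdivlMr ?ltr0n // mulrC ler_pdivrMr ?ltr0n // -natrM ler_nat.
    apply: ler_pM; rewrite ?exprn_ge0 ?invr_ge0 ?exprn_ge0 //; last exact: ltW.
    by rewrite -(powR_mulrn 4) // ler_powR // ler1n.
  - move=> _; split.
      by rewrite WG cG; apply: le_trans Wlarge; rewrite ler_pM2r //; lra.
    rewrite cG.
    have N1le : 1 <= N%:R :> R by rewrite ler1n.
    apply: (@le_trans _ _ N%:R); last by rewrite expr2 ler_peMl.
    apply: ler1_powR => //; rewrite -[leRHS](powRr0 c2).
    apply: ger_powR; last by rewrite divr_ge0 // ltW.
    by rewrite /c2 invr_gt0 exprn_gt0 ?ltr0n // invf_le1 ?exprn_gt0 ?ltr0n // exprn_ege1 // ler1n.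
  - by rewrite cardfs0 !mulr_gt0.
have rho1 : 1 <= rho by lra.
have eps_le1 : epsilon <= 1 by lra.
have hm := side_large rho_ge4 a0 alpha_small N_large.
have [s [s1 s2 s3 s4]] :=
  regular_partition W eps_gt0 K_gt0 rho1 alpha_small hm (steps_gt a0).
have s3' : (1 - epsilon) * N%:R ^+ 2 <= \sum_(C <- s) #|` rs_set C|%:R :> R.
  apply: le_trans s3; rewrite ler_wpM2r ?(ltW N2) // lerD2l lerN2.
  apply: le_trans (alpha_le_eps eps_gt0 eps_le1 K_le1 rho1).
  exact: steps_le a0 alpha_small.
have [M [P [B [P1 P2 P3 P4 P5]]]] := squares_of_partition eps_gt0 WN s1 s2 s3' s4.
exists M, P, B; split=> // i; have [Pd Ps] := P4 i; split=> //.
by rewrite card_rs_set; apply: size_large a0 alpha_small _ _ Ps.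
Qed.
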